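(* Let $Q_1\subset\mathbb R^{n_1}$, $Q_2\subset\mathbb R^{n_2}$ be convex compact sets, $Q=Q_1\times Q_2$, and let $f(u,v)$ be convex in $u$ and concave in $v$. Suppose that there is a $(\delta,L,V)$-model $\psi_\delta(x,y)$ for the saddle-point problem $\min_{u\in Q_1}\max_{v\in Q_2}f(u,v)$, with $\delta>0$, $L>0$. Run the generalized mirror prox method described in the context with this $\psi_\delta$, with $0<L_0\le2L$, auxiliary accuracy $\widetilde\delta\ge0$ and starting point $z_0=(u_0,v_0)$, and let $N$ be the number of iterations performed when it stops. Then the point $$\widehat y_N=(\widehat u_N,\widehat v_N):=\frac1{S_N}\sum_{k=0}^{N-1}\frac{w_k}{L_{k+1}},\qquad S_N=\sum_{k=0}^{N-1}\frac1{L_{k+1}},$$ satisfies $$\max_{v\in Q_2}f(\widehat u_N,v)-\min_{u\in Q_1}f(u,\widehat v_N)\le\frac{2L\max_{(u,v)\in Q}V[u_0,v_0](u,v)}{N}+2\widetilde\delta+2\delta.$$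
   Context: Points of $Q$ are written $x=(u_x,v_x)$, $y=(u_y,v_y)$. $d$ is a convex function on $Q$, continuously differentiable on the relative interior $\mathrm{ri}\,Q$, and $V[y](x)=d(x)-d(y)-\langle\nabla d(y),x-y\rangle$ for $x\in Q$, $y\in\mathrm{ri}\,Q$; $V[u_0,v_0](u,v)$ means $V[(u_0,v_0)]((u,v))$. Whenever $V[y](x)$ is written, $y$ is understood to be a point for which it is defined; in particular $z_k,w_k$ are assumed to be such points. $\max_{x\in Q}V[z_0](x)$ is assumed finite. $\psi_\delta:\mathbb R^{n_1+n_2}\times\mathbb R^{n_1+n_2}\to\mathbb R$ is a $(\delta,L,V)$-model for the saddle-point problem if for all $x,y,z\in Q$: $\psi_\delta(x,y)$ is convex in $x$; $\psi_\delta(x,x)=0$; $\psi_\delta(x,y)+\psi_\delta(y,x)\le\delta$; $\psi_\delta(x,y)\le\psi_\delta(x,z)+\psi_\delta(z,y)+LV[z](x)+LV[y](z)+\delta$; and $f(u_y,v_x)-f(u_x,v_y)\le-\psi_\delta(x,y)+\delta$. Inexact minimization: for convex $\Psi$ and $\widetilde\delta\ge0$, $\operatorname{argmin}^{\widetilde\delta}_{x\in Q}\Psi(x)$ denotes some point $\widetilde x\in Q$ for which there exists $h\in\partial\Psi(\widetilde x)$ with $\langle h,x-\widetilde x\rangle\ge-\widetilde\delta$ for all $x\in Q$. Generalized mirror prox: input $\varepsilon>0$, $\delta>0$, $L_0>0$. Set $z_0=\operatorname{argmin}_{x\in Q}d(x)$. For $k=0,1,2,\dots$: find the smallest integer $i_k\ge0$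 such that, with $L_{k+1}=2^{i_k-1}L_k$, $$w_k=\operatorname{argmin}^{\widetilde\delta}_{x\in Q}\{\psi_\delta(x,z_k)+L_{k+1}V[z_k](x)\},\qquad z_{k+1}=\operatorname{argmin}^{\widetilde\delta}_{x\in Q}\{\psi_\delta(x,w_k)+L_{k+1}V[z_k](x)\},$$ one has $$\psi_\delta(z_{k+1},z_k)\le\psi_\delta(z_{k+1},w_k)+\psi_\delta(w_k,z_k)+L_{k+1}\left(V[z_k](w_k)+V[w_k](z_{k+1})\right)+\delta.$$ The method stops after the first $N\ge1$ iterations for which $\sum_{k=0}^{N-1}\frac1{L_{k+1}}\ge\frac{\max_{x\in Q}V[z_0](x)}{\varepsilon}$. *)

(* Defs.v *)
From HB Require Import structures.
From mathcomp Require Import all_boot all_order all_algebra.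
From mathcomp Require Import all_classical all_reals all_analysis.

Set Implicit Arguments.
Unset Strict Implicit.
Unset Printing Implicit Defensive.

Import Order.TTheory GRing.Theory Num.Theory.
Import numFieldNormedType.Exports.

Local Open Scope classical_set_scope.
Local Open Scope ring_scope.

Definition dot (R : realType) (n : nat) (x y : 'rV[R]_n) : R :=
  \sum_(i < n) x ord0 i * y ord0 i.

(* A point x = (u_x, v_x) of R^{n1+n2} is a row vector with u_x = lsubmx x and
   v_x = rsubmx x. *)
Definition prod_set (R : realType) (n1 n2 : nat)
    (Q1 : set 'rV[R]_n1) (Q2 : set 'rV[R]_n2) : set 'rV[R]_(n1 + n2) :=
  [set x | Q1 (lsubmx x) /\ Q2 (rsubmx x)].

Definition affine_hull (R : realType) (n : nat) (Q : set 'rV[R]_n) :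
    set 'rV[R]_n :=
  [set x | exists (m : nat) (a : 'I_m -> R) (p : 'I_m -> 'rV[R]_n),
     [/\ forall i, Q (p i), \sum_i a i = 1 & x = \sum_i a i *: p i]].

Definition relint (R : realType) (n : nat) (Q : set 'rV[R]_n) :
    set 'rV[R]_n :=
  [set x | Q x /\ within (affine_hull Q) (nbhs x) Q].

(* Differentiability is relative to Q, so Q may have empty interior in R^n; the
   component of grad_d y orthogonal to the affine hull of Q is then arbitrary,
   but <grad_d y, x - y> is uniquely determined for x in Q. *)
Definition continuously_differentiable (R : realType) (n : nat)
    (Q : set 'rV[R]_n) (d : 'rV[R]_n -> R) (grad_d : 'rV[R]_n -> 'rV[R]_n) :
    Prop :=
  (forall y, relint Q y -> forall e, 0 < e ->
     \forall x \near within Q (nbhs y),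
       `|d x - d y - dot (grad_d y) (x - y)| <= e * `|x - y|)
  /\ {within relint Q, continuous grad_d}.

(* bregman d grad_d y x is V[y](x); it is only meaningful for y in relint Q. *)
Definition bregman (R : realType) (n : nat)
    (d : 'rV[R]_n -> R) (grad_d : 'rV[R]_n -> 'rV[R]_n) (y x : 'rV[R]_n) : R :=
  d x - d y - dot (grad_d y) (x - y).

(* In the fourth condition the base points y, z of V range over relint Q, where
   V[y] and V[z] are defined. *)
Record is_model (R : realType) (n1 n2 : nat)
    (Q : set 'rV[R]_(n1 + n2)) (f : 'rV[R]_n1 -> 'rV[R]_n2 -> R)
    (V : 'rV[R]_(n1 + n2) -> 'rV[R]_(n1 + n2) -> R) (delta L : R)
    (psi : 'rV[R]_(n1 + n2) -> 'rV[R]_(n1 + n2) -> R) : Prop := IsModel {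
  model_convex : forall y, Q y -> convex_function Q (fun x => psi x y) ;
  model_diag : forall x, Q x -> psi x x = 0 ;
  model_monotone : forall x y, Q x -> Q y -> psi x y + psi y x <= delta ;
  model_smooth : forall x y z, Q x -> relint Q y -> relint Q z ->
    psi x y <= psi x z + psi z y + L * V z x + L * V y z + delta ;
  model_gap : forall x y, Q x -> Q y ->
    f (lsubmx y) (rsubmx x) - f (lsubmx x) (rsubmx y) <= - psi x y + delta }.

Definition subdifferential (R : realType) (n : nat) (Q : set 'rV[R]_n)
    (Psi : 'rV[R]_n -> R) (x : 'rV[R]_n) : set 'rV[R]_n :=
  [set h | forall y, Q y -> Psi x + dot h (y - x) <= Psi y].

(* is_argmin Q d~ Psi x: x is an admissible value of argmin^{d~}_Q Psi. *)
Definition is_argmin (R : realType) (n : nat) (Q : set 'rV[R]_n)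
    (tdelta : R) (Psi : 'rV[R]_n -> R) (x : 'rV[R]_n) : Prop :=
  Q x /\ exists2 h, subdifferential Q Psi x h &
                    forall y, Q y -> - tdelta <= dot h (y - x).

(* (w, z') is a candidate computed from z with the trial constant M. *)
Definition mp_candidate (R : realType) (n : nat) (Q : set 'rV[R]_n)
    (V psi : 'rV[R]_n -> 'rV[R]_n -> R) (tdelta M : R)
    (z w z' : 'rV[R]_n) : Prop :=
  [/\ is_argmin Q tdelta (fun x => psi x z + M * V z x) w,
      relint Q w
    & is_argmin Q tdelta (fun x => psi x w + M * V z x) z'].

Definition mp_accepts (R : realType) (n : nat)
    (V psi : 'rV[R]_n -> 'rV[R]_n -> R) (delta M : R)
    (z w z' : 'rV[R]_n) : Prop :=
  psi z' z <= psi z' w + psi w z + M * (V z w + V w z') + delta.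

Definition inv_sum (R : realType) (Ls : nat -> R) (N : nat) : R :=
  \sum_(k < N) (Ls k.+1)^-1.

(* The sequences Ls, i, z, w record the first N iterations of the method, at
   which it stops.  Since argmin^{d~} only denotes some point, i k is smallest
   in the sense that the candidates computed for j < i k were all rejected. *)
Record mirror_prox_run (R : realType) (n : nat) (Q : set 'rV[R]_n)
    (d : 'rV[R]_n -> R) (V psi : 'rV[R]_n -> 'rV[R]_n -> R)
    (eps delta tdelta L0 : R) (Ls : nat -> R) (i : nat -> nat)
    (z w : nat -> 'rV[R]_n) (N : nat) : Prop := MirrorProxRun {
  run_z0 : Q (z 0%N) /\ forall x, Q x -> d (z 0%N) <= d x ;
  run_z_relint : forall k, (k <= N)%N -> relint Q (z k) ;
  run_L0 : Ls 0%N = L0 ;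
  run_L : forall k, (k < N)%N -> Ls k.+1 = 2 ^ ((i k)%:Z - 1) * Ls k ;
  run_step : forall k, (k < N)%N ->
    mp_candidate Q V psi tdelta (Ls k.+1) (z k) (w k) (z k.+1) /\
    mp_accepts V psi delta (Ls k.+1) (z k) (w k) (z k.+1) ;
  run_smallest : forall k j, (k < N)%N -> (j < i k)%N ->
    exists w' z',
      mp_candidate Q V psi tdelta (2 ^ (j%:Z - 1) * Ls k) (z k) w' z' /\
      ~ mp_accepts V psi delta (2 ^ (j%:Z - 1) * Ls k) (z k) w' z' ;
  run_pos : (1 <= N)%N ;
  run_stop : sup [set V (z 0%N) x | x in Q] / eps <= inv_sum Ls N ;
  run_first : forall M, (1 <= M < N)%N ->
    inv_sum Ls M < sup [set V (z 0%N) x | x in Q] / eps }.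

Definition mp_average (R : realType) (n : nat) (Ls : nat -> R)
    (w : nat -> 'rV[R]_n) (N : nat) : 'rV[R]_n :=
  (inv_sum Ls N)^-1 *: \sum_(k < N) (Ls k.+1)^-1 *: w k.

(* Main.v *)
Require Import Defs.
From HB Require Import structures.
From mathcomp Require Import all_boot all_order all_algebra.
From mathcomp Require Import all_classical all_reals all_analysis.
From mathcomp Require Import ring lra.

(* Differentiability of d at w turns an inexact minimizer w of g + M V[z] into
   the prox inequality
     g w + M V[z](w) + M V[w](x) <= g x + M V[z](x) + tdelta.
   Used for w_k at x = z_{k+1}, then for z_{k+1} at an arbitrary x, and combined
   with the acceptance test, it gives
     - psi(x, w_k) <= M V[z_k](x) - M V[z_{k+1}](x) + 2 tdelta + delta
   with M = L_{k+1}. Dividing by M, the right-hand side telescopes, and by the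
   model gap condition and Jensen's inequality the duality gap at the average is
   at most V[z_0](x) / S_N + 2 tdelta + 2 delta. Trial constants M >= L are
   always accepted, so L_{k+1} <= 2 L and S_N >= N / (2 L). *)

Set Implicit Arguments.
Unset Strict Implicit.
Unset Printing Implicit Defensive.

Import Order.TTheory GRing.Theory Num.Theory.
Import numFieldNormedType.Exports.

Local Open Scope classical_set_scope.
Local Open Scope ring_scope.

(** * Linearity of the inner product in its second argument *)

Section Dot.
Context {R : realType} {n : nat}.
Implicit Types x y z : 'rV[R]_n.

Lemma dotDr x y z : dot x (y + z) = dot x y + dot x z.
Proof.
by rewrite /dot -big_split; apply: eq_bigr => i _; rewrite mxE mulrDr.
Qed.

Lemma dotZr (t : R) x y : dot x (t *: y) = t * dot x y.
Proof.
by rewrite /dot mulr_sumr; apply: eq_bigr => i _; rewrite mxE mulrCA.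
Qed.

Lemma dotBr x y z : dot x (y - z) = dot x y - dot x z.
Proof. by rewrite -scaleN1r dotDr dotZr mulN1r. Qed.

End Dot.

(** As [c] is finite, terms can be moved across the inequality, and supremum and infimum are tested
    pointwise without first being shown finite. *)
Lemma ereal_sup_sub_inf_le (R : realType) (S T : Type) (A : set S) (B : set T)
    (g : S -> R) (h : T -> R) (c : R) :
  (forall s t, A s -> B t -> g s - h t <= c) ->
  (ereal_sup [set (g s)%:E | s in A] - ereal_inf [set (h t)%:E | t in B]
   <= c%:E)%E.
Proof.
move=> gh_le; rewrite lee_subel_addr// -leeBlDl//.
apply/ereal_infP => _ [t Bt <-]; rewrite leeBlDl//.
apply/ereal_supP => _ [s As <-]; rewrite -EFinD lee_fin -lerBlDr.
exact: gh_le.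
Qed.

(** * Weighted averages and Jensen's inequality *)

Section ConvexCombinations.
Context {R : realType} {E : lmodType R}.
Implicit Types (Q : set E) (g : E -> R) (a : nat -> R) (p : nat -> E).

Lemma convex_set_comb Q x y (t : R) : convex_set Q -> Q x -> Q y ->
  0 <= t <= 1 -> Q (t *: x + (1 - t) *: y).
Proof.
move=> cQ Qx Qy /andP[t0 t1].
by move: (cQ x y (Itv01 t0 t1)); rewrite !in_setE; exact.
Qed.

Lemma convex_function_comb Q g x y (t : R) : convex_function Q g ->
  Q x -> Q y -> 0 <= t <= 1 ->
  g (t *: x + (1 - t) *: y) <= t * g x + (1 - t) * g y.
Proof.
move=> cg Qx Qy /andP[t0 t1].
by move: (cg (Itv01 t0 t1) x y); rewrite !in_setE; exact.
Qed.

Let average a p N : E :=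
  (\sum_(k < N) a k)^-1 *: \sum_(k < N) a k *: p k.

Let sum_gt0 a N : (forall k, (k < N.+1)%N -> 0 < a k) ->
  0 < \sum_(k < N.+1) a k.
Proof.
move=> a0; rewrite big_ord_recr/= ltr_wpDl ?a0// sumr_ge0// => k _.
by rewrite ltW// a0// (ltn_trans (ltn_ord k)).
Qed.

(** Peeling off the last point leaves a binary combination, so averages can be handled by induction;
    the product identities clear the denominators. *)
Let average_recr a p N : (forall k, (k < N.+2)%N -> 0 < a k) ->
  exists2 t : R, 0 <= t <= 1 &
    [/\ average a p N.+2 = t *: p N.+1 + (1 - t) *: average a p N.+1,
        t * \sum_(k < N.+2) a k = a N.+1 &
        (1 - t) * \sum_(k < N.+2) a k = \sum_(k < N.+1) a k].
Proof.
move=> a0; have S2 := sum_gt0 a0.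
have S1 : 0 < \sum_(k < N.+1) a k by apply: sum_gt0 => k /ltnW; exact: a0.
have aN : 0 < a N.+1 by exact: a0.
move: S2; rewrite /average !(big_ord_recr N.+1)/=.
set S := \sum_(k < N.+1) a k in S1 *; set P := \sum_(k < N.+1) _ => S2.
have nS : S != 0 by rewrite gt_eqF.
have nS2 : S + a N.+1 != 0 by rewrite gt_eqF.
exists (a N.+1 / (S + a N.+1)).
  by rewrite ler_pdivrMr// mul1r lerDr (ltW S1) divr_ge0// ltW.
split; [|by field|by field].
rewrite scalerDr [LHS]addrC !scalerA [_^-1 * _]mulrC; congr (_ + _ *: _).
by field; rewrite nS.
Qed.

Lemma convex_set_average Q a p N : convex_set Q ->
  (forall k, (k < N.+1)%N -> 0 < a k) -> (forall k, (k < N.+1)%N -> Q (p k)) ->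
  Q ((\sum_(k < N.+1) a k)^-1 *: \sum_(k < N.+1) a k *: p k).
Proof.
move=> cQ; rewrite -/(average a p N.+1).
elim: N => [|N IH] a0 Qp.
  rewrite /average !big_ord1 scalerA mulVf ?scale1r; first exact: Qp.
  by rewrite gt_eqF// a0.
have [t t01 [-> _ _]] := average_recr p a0.
apply: convex_set_comb => //; first exact: Qp.
by apply: IH => k /ltnW; [exact: a0|exact: Qp].
Qed.

(** Jensen's inequality, multiplied by the total weight to match the weighted sums that bound the
    gap. *)
Lemma convex_function_average Q g a p N : convex_set Q -> convex_function Q g ->
  (forall k, (k < N.+1)%N -> 0 < a k) -> (forall k, (k < N.+1)%N -> Q (p k)) ->
  (\sum_(k < N.+1) a k) *
    g ((\sum_(k < N.+1) a k)^-1 *: \sum_(k < N.+1) a k *: p k) <=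
  \sum_(k < N.+1) a k * g (p k).
Proof.
move=> cQ cg; rewrite -/(average a p N.+1).
elim: N => [|N IH] a0 Qp.
  rewrite /average !big_ord1 scalerA mulVf ?scale1r//.
  by rewrite gt_eqF// a0.
have a0' k : (k < N.+1)%N -> 0 < a k by move=> /ltnW; exact: a0.
have Qp' k : (k < N.+1)%N -> Q (p k) by move=> /ltnW; exact: Qp.
have [t t01 [-> tS tS']] := average_recr p a0.
have S2 := sum_gt0 a0.
apply: (@le_trans _ _ ((\sum_(k < N.+2) a k) *
    (t * g (p N.+1) + (1 - t) * g (average a p N.+1)))).
  rewrite ler_pM2l//; apply: convex_function_comb => //; first exact: Qp.
  exact: (convex_set_average cQ a0' Qp').
rewrite mulrDr !mulrA ![_ * t]mulrC ![_ * (1 - t)]mulrC tS tS'.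
by rewrite [leRHS]big_ord_recr/= [leLHS]addrC lerD2r IH.
Qed.

End ConvexCombinations.

Lemma convex_prod_set (R : realType) (n1 n2 : nat)
    (Q1 : set 'rV[R]_n1) (Q2 : set 'rV[R]_n2) :
  convex_set Q1 -> convex_set Q2 -> convex_set (prod_set Q1 Q2).
Proof.
move=> cQ1 cQ2 x y t; rewrite !in_setE => -[x1 x2] [y1 y2]; split.
- have /set_mem := cQ1 _ _ t (mem_set x1) (mem_set y1).
  by congr Q1; rewrite /conv/= linearD !linearZ.
- have /set_mem := cQ2 _ _ t (mem_set x2) (mem_set y2).
  by congr Q2; rewrite /conv/= linearD !linearZ.
Qed.

(** * Bregman divergences and the inexact prox step *)

Section Bregman.
Context {R : realType} {n : nat}.
Variables (Q : set 'rV[R]_n) (d : 'rV[R]_n -> R) (grad_d : 'rV[R]_n -> 'rV[R]_n).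
Hypotheses (cQ : convex_set Q) (d_C1 : continuously_differentiable Q d grad_d).
Local Notation V := (bregman d grad_d).

(** One small [t] for each [e] replaces a limit. Convexity keeps the segment in [Q], where
    differentiability relative to [Q] applies. *)
Lemma directional_expansion y x (e : R) : relint Q y -> Q x -> 0 < e ->
  exists2 t : R, 0 < t <= 1 &
    `|d (t *: x + (1 - t) *: y) - d y - t * dot (grad_d y) (x - y)| <= e * t.
Proof.
move=> ry Qx e0; have [Qy _] := ry.
(* The extra 1 keeps the divisor positive when [x = y]. *)
set c := 1 + `|x - y|; have c0 : 0 < c by rewrite ltr_pwDl.
have ec0 : 0 < e / c by rewrite divr_gt0.
have /nbhs_ballP[r /= r0 yr] := d_C1.1 y ry _ ec0.
(* Halving [r] makes the displacement, at most [t * c], strictly smaller than the radius. *)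
pose t := Num.min 1 (r / 2 / c).
have t0 : 0 < t by rewrite lt_min ltr01/= !divr_gt0.
have t1 : t <= 1 by rewrite ge_min lexx.
have tr : t * c < r.
  apply: (@le_lt_trans _ _ (r / 2)); last by lra.
  by rewrite -ler_pdivlMr// ge_min lexx orbT.
have xyE : t *: x + (1 - t) *: y - y = t *: (x - y).
  by rewrite scalerBl scale1r addrCA addrAC subrr add0r scalerBr.
exists t; first by rewrite t0.
have nxy : `|t *: x + (1 - t) *: y - y| <= t * c.
  by rewrite xyE normrZ gtr0_norm// ler_pM2l// lerDr.
have := yr (t *: x + (1 - t) *: y); rewrite -ball_normE/= => /(_ _ _).
rewrite xyE dotZr => bnd; apply: le_trans (bnd _ _) _.
- by rewrite distrC (le_lt_trans nxy).
- by apply: convex_set_comb; rewrite // t1 ltW.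
- rewrite -xyE (le_trans (ler_wpM2l (ltW ec0) nxy))//.
  by rewrite [t * c]mulrC mulrA divfK// gt_eqF.
Qed.

(** Comparing the chord inequality with the expansion at the same point and dividing by [t] gives
    [- e <= V y x] for every positive [e]. *)
Lemma bregman_ge0 y x : convex_function Q d -> relint Q y -> Q x -> 0 <= V y x.
Proof.
move=> cd ry Qx; apply/ler_addgt0Pr => e e0.
have [t /andP[t0 t1]] := directional_expansion ry Qx e0.
rewrite ler_norml => /andP[lo _].
have := convex_function_comb cd Qx ry.1 (introT andP (conj (ltW t0) t1)).
rewrite -(pmulr_rge0 _ t0) /bregman; lra.
Qed.

(* The subgradient h of g + M V[z] at w is tested along the segment from w to x:
   as V[z] is differentiable at w, no sum rule for subdifferentials is needed. *)
Lemma prox_inequality (g : 'rV[R]_n -> R) (tdelta M : R) z w x :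
  convex_function Q g -> 0 <= M -> relint Q w -> Q x ->
  is_argmin Q tdelta (fun y => g y + M * V z y) w ->
  g w + M * V z w + M * V w x <= g x + M * V z x + tdelta.
Proof.
move=> cg M0 rw Qx [Qw [h hsub harg]]; apply/ler_addgt0Pr => e e0.
(* With this tolerance the expansion error times [M] is at most [e * t], even for [M = 0]. *)
have e1 : 0 < e / (1 + M) by rewrite divr_gt0// ltr_pwDl.
have [t /andP[t0 t1]] := directional_expansion rw Qx e1.
rewrite ler_norml => /andP[_ up].
have t01 : 0 <= t <= 1 by rewrite ltW.
have gt := convex_function_comb cg Qx Qw t01.
have {hsub} := hsub _ (convex_set_comb cQ Qx Qw t01).
have {harg} := harg _ Qx.
rewrite /bregman !dotBr !dotDr !dotZr => harg hsub.
rewrite !dotBr in up.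
have eM : M * (e / (1 + M)) <= e.
  by rewrite mulrCA ler_piMr ?(ltW e0)// ler_pdivrMr ?mul1r ?lerDr// ltr_pwDl.
have Mup := ler_wpM2l M0 up.
have tharg := ler_wpM2l (ltW t0) harg.
have teM := ler_wpM2l (ltW t0) eM.
(* Scaled by [t], the claim is the sum of the collected inequalities, by the three-point identity
   V[z](w) + V[w](x) - V[z](x) = <grad_d z - grad_d w, x - w>. *)
rewrite -(ler_pM2l t0).
rewrite -subr_ge0 in gt hsub Mup tharg teM *.
nra.
Qed.

Lemma mirror_step (psi : 'rV[R]_n -> 'rV[R]_n -> R) (delta tdelta M : R)
    z w z' x :
  (forall y, Q y -> convex_function Q (psi^~ y)) -> 0 <= M ->
  relint Q z -> relint Q z' -> Q x ->
  mp_candidate Q V psi tdelta M z w z' -> mp_accepts V psi delta M z w z' ->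
  - psi x w <= M * V z x - M * V z' x + 2 * tdelta + delta.
Proof.
move=> cpsi M0 rz rz' Qx [hw rw hz'] acc.
have p1 := prox_inequality (cpsi _ rz.1) M0 rw rz'.1 hw.
have p2 := prox_inequality (cpsi _ rw.1) M0 rz' Qx hz'.
(* In the sum of the three inequalities all terms in V[z](w), V[w](z') and V[z](z') cancel, as do
   all values of [psi] but [psi x w]. *)
move: acc p1 p2; rewrite /mp_accepts; lra.
Qed.

End Bregman.

(** Taken for [lsubmx] and [rsubmx], this puts both blocks of the average in the form required by
    Jensen's inequality. *)
Lemma linear_mp_average (R : realType) (n m : nat)
    (phi : {linear 'rV[R]_n -> 'rV[R]_m}) (Ls : nat -> R)
    (w : nat -> 'rV[R]_n) (N : nat) :
  phi (mp_average Ls w N) =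
  (\sum_(k < N) (Ls k.+1)^-1)^-1 *: \sum_(k < N) (Ls k.+1)^-1 *: phi (w k).
Proof.
rewrite linearZ/=; congr (_ *: _); rewrite linear_sum/=.
by apply: eq_bigr => k _; rewrite linearZ.
Qed.

(** * Bounds on the step constants and the telescoped gap *)

Section MirrorProx.
Context {R : realType} {n1 n2 : nat}.
Variables (Q1 : set 'rV[R]_n1) (Q2 : set 'rV[R]_n2)
  (f : 'rV[R]_n1 -> 'rV[R]_n2 -> R) (d : 'rV[R]_(n1 + n2) -> R)
  (grad_d : 'rV[R]_(n1 + n2) -> 'rV[R]_(n1 + n2))
  (psi : 'rV[R]_(n1 + n2) -> 'rV[R]_(n1 + n2) -> R)
  (eps delta tdelta L L0 : R)
  (Ls : nat -> R) (i : nat -> nat) (z w : nat -> 'rV[R]_(n1 + n2)) (N : nat).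
Local Notation Q := (prod_set Q1 Q2).
Local Notation V := (bregman d grad_d).
Hypotheses (hQ1 : convex_set Q1) (hQ2 : convex_set Q2)
  (d_convex : convex_function Q d)
  (d_C1 : continuously_differentiable Q d grad_d)
  (L_gt0 : 0 < L) (L0_gt0 : 0 < L0) (L0_le : L0 <= 2 * L)
  (psi_model : is_model Q f V delta L psi)
  (run : mirror_prox_run Q d V psi eps delta tdelta L0 Ls i z w N).

Let cQ : convex_set Q := convex_prod_set hQ1 hQ2.

Lemma step_const_gt0 k : (k <= N)%N -> 0 < Ls k.
Proof.
elim: k => [|k IH] kN; first by rewrite (run_L0 run).
by rewrite (run_L run)// mulr_gt0 ?IH 1?ltnW// exprz_gt0.
Qed.

(** The fourth model condition is the acceptance test with constant [L]; as V is nonnegative, [L]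
    may be raised to [M]. *)
Lemma candidate_accepted M x y x' : L <= M -> relint Q x ->
  mp_candidate Q V psi tdelta M x y x' -> mp_accepts V psi delta M x y x'.
Proof.
move=> LM rx [_ ry [Qx' _]].
have := model_smooth psi_model Qx' rx ry.
have V1 := bregman_ge0 cQ d_C1 d_convex ry Qx'.
have V2 := bregman_ge0 cQ d_C1 d_convex rx ry.1.
have := ler_wpM2r V1 LM; have := ler_wpM2r V2 LM.
rewrite /mp_accepts; lra.
Qed.

(* If i k > 0, the previous trial constant, half of Ls k.+1, was rejected, and
   by candidate_accepted only constants below L can be. *)
Lemma step_const_le k : (k <= N)%N -> Ls k <= 2 * L.
Proof.
elim: k => [|k IH] kN; first by rewrite (run_L0 run).
have Lk0 := step_const_gt0 (ltnW kN).
rewrite (run_L run)//; case ik : (i k) => [|j].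
  (* Acceptance at the first trial halves the constant. *)
  rewrite sub0r exprN1; have := IH (ltnW kN); lra.
have [|y [x' [cand rej]]] := @run_smallest _ _ _ _ _ _ _ _ _ _ _ _ _ _ _ run k j kN.
  by rewrite ik.
have : 2 ^ (j%:Z - 1) * Ls k < L.
  rewrite ltNge; apply/negP => LM; apply: rej.
  by apply: candidate_accepted cand => //; exact: (run_z_relint run (ltnW kN)).
have -> : 2 ^ (j.+1%:Z - 1) = 2 * 2 ^ (j%:Z - 1) :> R.
  by rewrite intS -addrA expfzDr.
lra.
Qed.

Lemma inv_sum_ge : N%:R / (2 * L) <= inv_sum Ls N.
Proof.
rewrite /inv_sum -[N in N%:R]card_ord -sum1_card natr_sum mulr_suml.
apply: ler_sum => k _; rewrite mul1r.
by rewrite lef_pV2 ?posrE ?mulr_gt0 ?step_const_gt0 ?step_const_le.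
Qed.

Lemma gap_sum_le x : Q x ->
  \sum_(k < N) (Ls k.+1)^-1 *
    (f (lsubmx (w k)) (rsubmx x) - f (lsubmx x) (rsubmx (w k))) <=
  V (z 0%N) x + inv_sum Ls N * (2 * tdelta + 2 * delta).
Proof.
move=> Qx.
(* The induction must carry - V[z_m](x) for the sum to telescope; at [m = N] this term is dropped by
   nonnegativity. *)
suff H m : (m <= N)%N -> \sum_(k < m) (Ls k.+1)^-1 *
    (f (lsubmx (w k)) (rsubmx x) - f (lsubmx x) (rsubmx (w k))) <=
    V (z 0%N) x - V (z m) x + inv_sum Ls m * (2 * tdelta + 2 * delta).
  apply: le_trans (H N (leqnn _)) _; rewrite lerD2r gerBl.
  exact: (bregman_ge0 cQ d_C1 d_convex (run_z_relint run (leqnn _)) Qx).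
elim: m => [|m IH] mN; first by rewrite /inv_sum !big_ord0 subrr mul0r addr0.
have M0 := step_const_gt0 mN.
have [cand acc] := run_step run mN; have [_ [Qw _] _] := cand.
have := mirror_step cQ d_C1 (model_convex psi_model) (ltW M0)
  (run_z_relint run (ltnW mN)) (run_z_relint run mN) Qx cand acc.
have := model_gap psi_model Qx Qw.
rewrite /inv_sum !big_ord_recr/= -/(inv_sum Ls m).
move: (f _ _ - _) (psi _ _) (V (z m) x) (V (z m.+1) x) (IH (ltnW mN)) => D p a b.
move=> IHm Dp pa.
(* One [delta] comes from the acceptance test, the other from the model gap condition. *)
have {Dp pa}: D <= Ls m.+1 * a - Ls m.+1 * b + (2 * tdelta + 2 * delta) by lra.
rewrite -(@ler_pM2l _ (Ls m.+1)^-1) ?invr_gt0//.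
rewrite -mulrBr mulrDr mulKf ?gt_eqF//; lra.
Qed.

End MirrorProx.
Theorem theorem4p11 (R : realType) (n1 n2 : nat)
    (Q1 : set 'rV[R]_n1) (Q2 : set 'rV[R]_n2)
    (f : 'rV[R]_n1 -> 'rV[R]_n2 -> R)
    (d : 'rV[R]_(n1 + n2) -> R)
    (grad_d : 'rV[R]_(n1 + n2) -> 'rV[R]_(n1 + n2))
    (psi : 'rV[R]_(n1 + n2) -> 'rV[R]_(n1 + n2) -> R)
    (eps delta tdelta L L0 : R)
    (Ls : nat -> R) (i : nat -> nat) (z w : nat -> 'rV[R]_(n1 + n2))
    (N : nat)
    (Q := prod_set Q1 Q2) (V := bregman d grad_d)
    (hQ1 : convex_set Q1) (cQ1 : compact Q1)
    (hQ2 : convex_set Q2) (cQ2 : compact Q2)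
    (f_convex : forall v, Q2 v -> convex_function Q1 (fun u => f u v))
    (f_concave : forall u, Q1 u -> convex_function Q2 (fun v => - f u v))
    (d_convex : convex_function Q d)
    (d_C1 : continuously_differentiable Q d grad_d)
    (eps_gt0 : 0 < eps) (delta_gt0 : 0 < delta) (tdelta_ge0 : 0 <= tdelta)
    (L_gt0 : 0 < L) (L0_gt0 : 0 < L0) (L0_le : L0 <= 2 * L)
    (psi_model : is_model Q f V delta L psi)
    (V_finite : has_ubound [set V (z 0%N) x | x in Q])
    (run : mirror_prox_run Q d V psi eps delta tdelta L0 Ls i z w N)
    (y_hat := mp_average Ls w N)
    (u_hat := lsubmx y_hat) (v_hat := rsubmx y_hat) :
  (ereal_sup [set (f u_hat v)%:E | v in Q2]
     - ereal_inf [set (f u v_hat)%:E | u in Q1]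
   <= (2 * L * sup [set V (z 0%N) x | x in Q] / N%:R
       + 2 * tdelta + 2 * delta)%:E)%E.
Proof.
have S_gt0 : 0 < inv_sum Ls N.
  rewrite (lt_le_trans _ (inv_sum_ge hQ1 hQ2 d_convex d_C1 L_gt0 L0_gt0 L0_le
    psi_model run))// divr_gt0 ?mulr_gt0// ltr0n; exact: run_pos run.
apply: ereal_sup_sub_inf_le => v u Qv Qu.
(* The competitors of both players form one test point for the gap bound. *)
pose x := row_mx u v.
have Qx : Q x by rewrite /Q /prod_set/= row_mxKl row_mxKr.
have gap := gap_sum_le hQ1 hQ2 d_convex d_C1 L0_gt0 psi_model run Qx.
have S_ge := inv_sum_ge hQ1 hQ2 d_convex d_C1 L_gt0 L0_gt0 L0_le psi_model run.
have Ls_gt0 := step_const_gt0 L0_gt0 run.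
have V_le : V (z 0%N) x <= sup [set V (z 0%N) x | x in Q].
  by apply: ub_le_sup => //; exists x.
have V_ge0 : 0 <= V (z 0%N) x.
  apply: bregman_ge0 Qx => //; first exact: convex_prod_set.
  exact: (run_z_relint run).
have N_gt0 := run_pos run.
have Qw k : (k < N)%N -> Q (w k) by move=> /(run_step run)[[_ []]].
(* Jensen's inequality is stated for nonempty sums, so [N] becomes a successor. *)
case: N N_gt0 @y_hat @u_hat @v_hat gap S_gt0 S_ge Ls_gt0 Qw {run} => // m _.
move=> y_hat u_hat v_hat gap S_gt0 S_ge Ls_gt0 Qw.
have a_gt0 k : (k < m.+1)%N -> 0 < (Ls k.+1)^-1 by rewrite invr_gt0; exact: Ls_gt0.
have := convex_function_average (p := fun k => lsubmx (w k)) hQ1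
  (f_convex v Qv) a_gt0 (fun k km => (Qw k km).1).
have := convex_function_average (p := fun k => rsubmx (w k)) hQ2
  (f_concave u Qu) a_gt0 (fun k km => (Qw k km).2).
rewrite -!linear_mp_average -/(inv_sum Ls m.+1) => Jv Ju.
have /le_trans/(_ gap) : inv_sum Ls m.+1 * (f u_hat v - f u v_hat) <=
    \sum_(k < m.+1) (Ls k.+1)^-1 *
      (f (lsubmx (w k)) (rsubmx x) - f (lsubmx x) (rsubmx (w k))).
  rewrite mulrDr (le_trans (lerD Ju Jv))// -big_split/=.
  by rewrite row_mxKl row_mxKr; apply: ler_sum => k _; rewrite mulrDr.
rewrite -ler_pdivlMl// mulrDr mulKf ?gt_eqF// => /le_trans; apply.
(* First S_N is replaced by its lower bound N / (2 L), as V[z_0](x) is nonnegative, then V[z_0](x)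
   by its supremum. *)
rewrite addrA !lerD2r mulrC (le_trans (y := V (z 0%N) x / (m.+1%:R / (2 * L))))//.
  by rewrite ler_wpM2l// lef_pV2// posrE// divr_gt0// mulr_gt0.
by rewrite invf_div mulrA ler_pM2r ?invr_gt0 ?ltr0n// mulrC ler_pM2l ?mulr_gt0.
Qed.
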